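(* Let $G$ be a finite group and let $\mathsf{S}$ be a supercharacter theory of $G$ for which $G$ is $\mathsf{S}$-nilpotent. Then $\chi(1)$ divides $|G:\ker(\chi)|$ for each $\chi\in\mathrm{Ch}(\mathsf{S})$, and $|\mathrm{cl}_{\mathsf{S}}(g)|$ divides $|G|$ for each $g\in G$.
   Context: Let $G$ be a finite group and $\mathrm{Irr}(G)$ its set of complex irreducible characters. A supercharacter theory $\mathsf{S}$ of $G$ is a pair $(\mathcal{X}_{\mathsf{S}},\mathcal{K}_{\mathsf{S}})$, where $\mathcal{X}_{\mathsf{S}}$ is a partition of $\mathrm{Irr}(G)$ and $\mathcal{K}_{\mathsf{S}}$ is a partition of $G$, such that $\{1\}\in\mathcal{K}_{\mathsf{S}}$, $|\mathcal{X}_{\mathsf{S}}|=|\mathcal{K}_{\mathsf{S}}|$, and for each $X\in\mathcal{X}_{\mathsf{S}}$ there is a (nonzero) character $\xi_X$ whose constituents lie in $X$ and which is constant on the parts of $\mathcal{K}_{\mathsf{S}}$. It is known that then every part of $\mathcal{K}_{\mathsf{S}}$ is a union of conjugacy classes, and $\xi_X$ is up to a scalar $\sigma_X=\sum_{\psi\in X}\psi(1)\psi$. The parts of $\mathcal{K}_{\mathsf{S}}$ are called $\mathsf{S}$-classes, $\mathrm{Cl}(\mathsf{S})$ is the set of them, and $\mathrm{cl}_{\mathsf{S}}(g)$ is the $\mathsf{S}$-class containing $g$. The characters $\sigma_X$, $X\in\mathcal{X}_{\mathsf{S}}$, are called $\mathsf{S}$-characters, and $\mathrm{Ch}(\mathsf{S})$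 is the set of them. A subgroup $N\le G$ is $\mathsf{S}$-normal if it is a union of $\mathsf{S}$-classes. If $N$ is $\mathsf{S}$-normal, there is a (known) induced supercharacter theory $\mathsf{S}^{G/N}$ of $G/N$ whose classes are the images $\pi(K)$ of the $\mathsf{S}$-classes $K$ under the projection $\pi:G\to G/N$, and whose characters are the $\mathsf{S}$-characters containing $N$ in their kernel, viewed as characters of $G/N$. The subgroup $\mathbf{Z}(\mathsf{S})=\{g\in G:|\mathrm{cl}_{\mathsf{S}}(g)|=1\}$ is defined for every supercharacter theory. An $\mathsf{S}$-central series is a series $G=N_1\ge N_2\ge\dotsb\ge N_{r+1}=1$ of $\mathsf{S}$-normal subgroups with $N_i/N_{i+1}\le\mathbf{Z}(\mathsf{S}^{G/N_{i+1}})$ for all $1\le i\le r$. $G$ is $\mathsf{S}$-nilpotent if $G$ has an $\mathsf{S}$-central series. *)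

(* Defs.v *)
From mathcomp Require Export all_boot all_order all_algebra all_fingroup.
From mathcomp Require Export all_solvable all_field all_character.

Set Implicit Arguments.
Unset Strict Implicit.
Unset Printing Implicit Defensive.

Import GRing.Theory.
Local Open Scope ring_scope.

(* The raw pair (X_S, K_S), without the axioms, which are stated separately   *)
(* in [supercharacter_theory]. Irreducible characters are represented by      *)
(* their indices in [Iirr G].                                                 *)
Record superdata (gT : finGroupType) (G : {group gT}) := Superdata {
  charParts : {set {set Iirr G}};
  Cl : {set {set gT}}
}.

Section Supercharacters.

Variables (gT : finGroupType) (G : {group gT}).
Implicit Types (S : superdata G) (X : {set Iirr G}) (N : {group gT}).

(* The test [xi != 0] is needed because [0 \is a character] holds.            *)
Definition supercharacter_theory S : Prop :=
  [/\ partition (charParts S) [set: Iirr G],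
      partition (Cl S) G,
      [set 1%g] \in Cl S,
      #|charParts S| = #|Cl S|
    & forall X, X \in charParts S ->
        exists xi : 'CF(G),
          [/\ xi \is a character, xi != 0, {subset irr_constt xi <= X}
            & forall K, K \in Cl S -> {in K &, forall x y, xi x = xi y}]].

Definition supercl S (g : gT) : {set gT} := pblock (Cl S) g.

Definition superchar X : 'CF(G) := \sum_(i in X) 'chi_i 1%g *: 'chi_i.

Definition Ch S : seq 'CF(G) := [seq superchar X | X in charParts S].

Definition superNormal S N : bool :=
  [exists A : {set {set gT}}, (A \subset Cl S) && (N :==: cover A)].

(* Used when [N] is S-normal, hence normal in [G] since S-classes are unions  *)
(* of conjugacy classes: [K / N] is then the full image of [K] in [G / N].    *)
(* If moreover [N] lies in the kernel of the S-character of [X], it lies in   *)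
(* the kernel of every 'chi_i with [i \in X], and [quo_Iirr N i] indexes      *)
(* 'chi_i viewed as a character of [G / N].                                   *)
Definition superQuo S N : superdata (G / N)%G :=
  Superdata
    [set [set quo_Iirr N i | i in X] | X : {set Iirr G} in charParts S
                                     & N \subset cfker (superchar X)]
    [set (K / N)%g | K : {set gT} in Cl S].

Definition superCenter S : {set gT} := [set g in G | #|supercl S g| == 1%N].

End Supercharacters.

(* The terms are N 0, ..., N r; the values of [N] beyond [r] are irrelevant.  *)
Definition superCentralSeries (gT : finGroupType) (G : {group gT})
    (S : superdata G) (r : nat) (N : nat -> {group gT}) : Prop :=
  [/\ N 0%N :=: G, N r :=: 1%g,
      forall i, (i <= r)%N -> superNormal S (N i)
    & forall i, (i < r)%N ->
        N i.+1 \subset N i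
        /\ (N i / N i.+1)%g \subset superCenter (superQuo S (N i.+1))].

Definition superNilpotent (gT : finGroupType) (G : {group gT})
    (S : superdata G) : Prop :=
  exists r N, superCentralSeries S r N.

(* Main.v *)
Require Import Defs.

Set Implicit Arguments.
Unset Strict Implicit.
Unset Printing Implicit Defensive.

Import GRing.Theory Num.Theory.

(** Both halves of the theorem are proved inside G, by comparing consecutive
terms N <= M of a central series; the quotient theories enter only through the
reformulation [superCenter_quo] of centrality: cl(m) lies in mN for all m in M
([supercentral_mod]).

The starting point is the counting condition on the numbers of parts.  The
characters attached to the parts of Irr(G) are linearly independent and as
numerous as the S-classes, so they span the functions that are constant on
S-classes.  The regular character is such a function, and its components along
the parts are the S-characters sigma_X; hence the sigma_X span too
([superchar_basis]).  Therefore this space is closed under convolution, and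
products of unions of S-classes are again unions of S-classes
([superclosedM]); dually, every character that is constant on S-classes
contains all of X or nothing of it among its constituents
([constt_superclass_function]).

For the S-classes, let K = cl(g).  For m in M, the set KNm equals K cl(m) N, a
union of S-classes.  If two of these sets meet, then after a translation that
takes the first one back to KN, the second one contains a point of K, hence all
of K; so the two coincide.  Thus KM is
partitioned into translates of KN, and |KN| divides |KM|
([dvdn_card_superclass_mul]).  Along the series, |K| divides |KG| = |G|.

For the S-characters the argument is dualized: restriction replaces the product
with a subgroup, and multiplication by the linear characters of M/N replaces
translation by M.  Let w(phi) be the sum of theta(1)^2 over the constituents
theta of phi.  If T is the set of constituents of sigma_X restricted to M, then
the irreducible characters of M lying over constituents of Res_N sigma_X form
the union of the T lambda, for lambda linear with N in its kernel.  Inducing lambda to G gives a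
class function constant on S-classes, which forces these sets to be equal or
disjoint.  Each has weight w(Res_M sigma_X), so that |M : N| w(Res_N sigma_X)
is an integer multiple of it ([constt_weight_supercentral]).  The series is
multiplied by the kernel L of sigma_X, so as to go from G, where the weight is
sigma_X(1), to L, where it is 1; multiplying the steps gives |G : L| as a
multiple of sigma_X(1). *)

(** * The sums of psi(1) psi over a set of irreducible characters *)

Section Supercharacters.

Local Open Scope ring_scope.

Variables (gT : finGroupType) (G : {group gT}).

Lemma cfdot_superchar (X : {set Iirr G}) i :
  '[superchar X, 'chi[G]_i] = if i \in X then 'chi_i 1%g else 0.
Proof.
rewrite cfdot_suml; case: ifP => [Xi | X'i].
  rewrite (bigD1 i) //= cfdotZl cfnorm_irr mulr1 big1 ?addr0 // => j.
  case/andP=> _ ne.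
  by rewrite cfdotZl cfdot_irr (negPf ne) mulr0.
rewrite big1 // => j Xj; rewrite cfdotZl cfdot_irr.
by case: eqP => [eq_ji | _]; [rewrite -eq_ji Xj in X'i | rewrite mulr0].
Qed.

Lemma superchar_char (X : {set Iirr G}) : superchar X \is a character.
Proof.
by apply: rpred_sum => i _; rewrite rpredZ_nat ?irr_char ?Cnat_irr1.
Qed.

Lemma constt_superchar (X : {set Iirr G}) : irr_constt (superchar X) =i X.
Proof.
by move=> i; rewrite inE cfdot_superchar; case: ifP; rewrite ?irr1_neq0 ?eqxx.
Qed.

End Supercharacters.

(** * Constituents of restrictions and of twists by linear characters *)

Section ConstituentDegrees.

Local Open Scope group_scope.
Local Open Scope ring_scope.

Variable gT : finGroupType.
Implicit Types M N : {group gT}.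

Lemma cfdot_char_neq0P M (phi psi : 'CF(M)) :
    phi \is a character -> psi \is a character ->
  reflect (exists2 i, i \in irr_constt phi & i \in irr_constt psi)
          ('[phi, psi] != 0).
Proof.
move=> Nphi Npsi; apply: (iffP idP) => [nz | [i phi_i psi_i]].
  have /existsP[i /andP[phi_i psi_i]]:
    [exists i, (i \in irr_constt phi) && (i \in irr_constt psi)].
    apply: contraR nz => /existsPn no_i; rewrite cfdot_sum_irr big1 // => i _.
    by have:= no_i i; rewrite !inE negb_and !negbK => /orP[] /eqP->;
      rewrite ?rmorph0 ?mul0r ?mulr0.
  by exists i.
apply/eqP=> /(constt_ortho_char Nphi Npsi phi_i psi_i)/eqP.
by rewrite cfnorm_irr oner_eq0.
Qed.

Lemma cfdot_mul_conj M (phi psi theta : 'CF(M)) :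
  '[phi * psi, theta] = '[phi, theta * psi^*%CF].
Proof.
rewrite !cfdotE; congr (_ * _); apply: eq_bigr => x _.
by rewrite !cfunE rmorphM /= conjCK -mulrA [psi x * _]mulrC.
Qed.

Lemma constt_mulS M (phi phi' psi : 'CF(M)) :
    phi \is a character -> phi' \is a character -> psi \is a character ->
    {subset irr_constt phi <= irr_constt phi'} ->
  {subset irr_constt (phi * psi) <= irr_constt (phi' * psi)}.
Proof.
move=> Nphi Nphi' Npsi sub j; rewrite !irr_consttE !cfdot_mul_conj.
have Nj : 'chi_j * psi^*%CF \is a character.
  by rewrite rpredM ?irr_char ?cfConjC_char.
case/(cfdot_char_neq0P Nphi Nj) => i /sub phi'_i ji.
by apply/(cfdot_char_neq0P Nphi' Nj); exists i.
Qed.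

Lemma constt_ResS M N (phi phi' : 'CF(M)) :
    phi \is a character -> phi' \is a character ->
    {subset irr_constt phi <= irr_constt phi'} ->
  {subset irr_constt ('Res[N] phi) <= irr_constt ('Res[N] phi')}.
Proof.
move=> Nphi Nphi' sub j; rewrite !irr_consttE !cfdot_Res_l.
have Nj : 'Ind[M] 'chi_j \is a character by rewrite cfInd_char ?irr_char.
case/(cfdot_char_neq0P Nphi Nj) => i /sub phi'_i ji.
by apply/(cfdot_char_neq0P Nphi' Nj); exists i.
Qed.

Definition constts M (phi : 'CF(M)) := [set i in irr_constt phi].

(** This is the dimension of the two-sided ideal of the group algebra cut out by
the constituents of phi: the dual counterpart of the size of a union of
conjugacy classes. *)
Definition constt_weight M (phi : 'CF(M)) : algC :=
  superchar (constts phi) 1%g.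

(** On characters supported by X, pairing with the S-character of X agrees with
pairing with the regular character, which is evaluation at 1. *)
Lemma cfdot_superchar_char M (X : {set Iirr M}) (phi : 'CF(M)) :
    phi \is a character -> {subset irr_constt phi <= X} ->
  '[superchar X, phi] = phi 1%g.
Proof.
move=> Nphi sub; rewrite cfdot_char_r // [phi in RHS]cfun_sum_cfdot sum_cfunE.
apply: eq_bigr => i _; rewrite cfdot_superchar cfunE mulrC.
case: ifPn => // X'i; suff /eqP->: '[phi, 'chi_i] == 0 by rewrite !mul0r.
by apply: contraR X'i; apply: sub.
Qed.

Lemma cfInd_Res M N (chi : 'CF(M)) :
  N \subset M -> 'Ind[M] ('Res[N] chi) = chi * 'Ind[M, N] 1.
Proof. by move=> sNM; rewrite mulrC -cfIndM // mul1r. Qed.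

Lemma cfRes_Ind1 M N : N <| M -> 'Res[N] ('Ind[M, N] 1) = #|M : N|%:R%:A.
Proof.
move=> nsNM; apply/cfun_inP=> x Nx.
rewrite cfResE ?normal_sub // cfInd_cfun1 // !cfunE cfuniE //.
by rewrite cfun1E Nx.
Qed.

(** Every irreducible character over a constituent of Res_N chi has all its
N-constituents in Res_N chi, because Res Ind Res chi is a multiple of Res chi.
So inducing the sum of theta(1) theta over these constituents gives the sum of
psi(1) psi over the irreducible characters psi lying over them, and the equality
is its value at 1. *)
Lemma constt_weight_Ind_Res M N (chi : 'CF(M)) :
    N <| M -> chi \is a character ->
  constt_weight ('Ind[M] ('Res[N] chi))
    = #|M : N|%:R * constt_weight ('Res[N] chi).
Proof.
move=> nsNM Nchi; have sNM := normal_sub nsNM.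
have Nres : 'Res[N] chi \is a character by apply: cfRes_char.
have Nind : 'Ind[M] ('Res[N] chi) \is a character by apply: cfInd_char.
rewrite /constt_weight -cfInd1 //; congr (fun_of_cfun _ _).
rewrite [LHS]cfun_sum_cfdot [RHS]cfun_sum_cfdot; apply: eq_bigr => i _.
congr (_ *: _); rewrite cfdot_superchar -cfdot_Res_r inE.
have Ni : 'Res[N] 'chi[M]_i \is a character by rewrite cfRes_char ?irr_char.
case: ifPn => [ind_i | ind'i].
  rewrite cfdot_superchar_char ?cfRes1 // => j ij; rewrite inE.
  have: j \in irr_constt ('Res[N] ('Ind[M] ('Res[N] chi))).
    apply: constt_ResS ij; rewrite ?irr_char // => k.
    by rewrite constt_irr => /eqP->.
  rewrite cfInd_Res // rmorphM /= cfRes_Ind1 // mulr_algr irr_consttE cfdotZl.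
  by rewrite mulf_eq0 => /norP[].
apply/esym/eqP; apply: contraR ind'i.
case/(cfdot_char_neq0P (superchar_char _) Ni) => j.
rewrite constt_superchar inE => res_j i_j; rewrite irr_consttE -cfdot_Res_r.
by apply/(cfdot_char_neq0P Nres Ni); exists j.
Qed.

(** Twisting by a linear character permutes the irreducible characters and
preserves their degrees. *)
Lemma constt_weight_lin M (chi lambda : 'CF(M)) :
  lambda \is a linear_char -> constt_weight (chi * lambda) = constt_weight chi.
Proof.
move=> Llam; have Llam' : (lambda^*)%CF \is a linear_char.
  by rewrite cfConjC_lin_char.
have lamK : lambda * (lambda^*)%CF = 1 by apply: mul_conjC_lin_char.
pose h (xi : 'CF(M)) i := cfIirr (xi * 'chi_i).
have hE xi i : xi \is a linear_char -> 'chi_(h xi i) = xi * 'chi_i.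
  by move=> Lxi; rewrite cfIirrE // mul_lin_irr ?mem_irr.
rewrite /constt_weight !sum_cfunE (reindex (h lambda)) /=; last first.
  exists (h (lambda^*)%CF) => i _; apply: irr_inj; rewrite !hE //= mulrA.
    by rewrite [_ * lambda]mulrC lamK mul1r.
  by rewrite lamK mul1r.
apply: eq_big => [i | i _].
  by rewrite !inE hE // cfdot_mul_conj [lambda * _]mulrC -mulrA lamK mulr1.
by rewrite hE // !cfunE lin_char1 // mul1r.
Qed.

(** The constituents of Ind Res chi = chi * Ind 1 are covered by the twists of
the constituents of chi by the constituents lambda of Ind 1, which are linear as
M/N is abelian.  The hypothesis makes these twists pairwise equal or disjoint,
and they all have the same weight. *)
Lemma constt_weight_Res_multiple M N (chi : 'CF(M)) :
    N <| M -> (M^`(1) \subset N)%g -> chi \is a character ->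
    (forall lambda : 'CF(M),
      lambda \is a linear_char -> N \subset cfker lambda ->
      '[chi, chi * lambda] != 0 ->
      {subset irr_constt chi <= irr_constt (chi * lambda)}) ->
  exists m : nat,
    #|M : N|%:R * constt_weight ('Res[N] chi) = m%:R * constt_weight chi.
Proof.
move=> nsNM sM'N Nchi chiP; have sNM := normal_sub nsNM.
pose I := [set i in irr_constt ('Ind[M, N] 1)].
have Nind : 'Ind[M, N] 1 \is a character by rewrite cfInd_char ?cfun1_char.
have kerI i : i \in I -> N \subset cfker 'chi_i.
  rewrite inE => Ii; apply: subset_trans (cfker_constt Nind Ii).
  apply/subsetP=> x Nx; rewrite cfkerEchar // inE (subsetP sNM) //=.
  by rewrite cfInd_cfun1 // !cfunE !cfuniE // Nx group1 eqxx.
have linI i : i \in I -> 'chi_i \is a linear_char.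
  by move/kerI=> sNK; rewrite lin_irr_der1 (subset_trans sM'N).
have conjI i : i \in I -> ('chi_i)^*%CF \is a linear_char.
  by move=> Ii; rewrite cfConjC_lin_char linI.
pose T i := constts (chi * 'chi_i).
have subT i j k :
    i \in I -> j \in I -> k \in T i -> k \in T j -> T i \subset T j.
  move=> Ii Ij; rewrite !inE => ik jk.
  have Nij l : l \in I -> chi * 'chi_l \is a character.
    by move=> Il; rewrite rpredM ?irr_char.
  (* Undoing the twist by 'chi_i reduces to comparing chi with chi * lam. *)
  pose lam := 'chi_j * ('chi_i)^*%CF.
  have Llam : lam \is a linear_char by rewrite rpredM ?conjI ?linI.
  have Nlam := lin_charW Llam.
  have lamE : lam * 'chi_i = 'chi_j.
    by rewrite -mulrA [_ * 'chi_i]mulrC mul_conjC_lin_char ?linI ?mulr1.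
  have lamK : N \subset cfker lam.
    apply/subsetP=> x Nx; rewrite cfkerEchar // inE (subsetP sNM) //= !cfunE.
    by rewrite !cfker1 // (subsetP (kerI _ _)).
  have sub : {subset irr_constt chi <= irr_constt (chi * lam)}.
    apply: chiP => //.
    have -> : '[chi, chi * lam] = '[chi * 'chi_i, chi * 'chi_j].
      rewrite cfdot_mul_conj; congr '[_, _].
      by rewrite -mulrA.
    by apply/(cfdot_char_neq0P (Nij i Ii) (Nij j Ij)); exists k.
  have := constt_mulS Nchi (rpredM Nchi Nlam) (irr_char i) sub.
  rewrite -mulrA lamE => subij; apply/subsetP=> l; rewrite !inE.
  exact: subij.
have coverT : cover (T @: I) = constts ('Ind[M] ('Res[N] chi)).
  apply/setP=> l; rewrite inE irr_consttE cfInd_Res // mulrC cfdot_mul_conj.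
  have Nl : 'chi_l * (chi^*)%CF \is a character.
    by rewrite rpredM ?irr_char ?cfConjC_char.
  apply/bigcupP/(cfdot_char_neq0P Nind Nl)
    => [[_ /imsetP[i Ii ->]] | [i Ii li]].
    rewrite inE irr_consttE mulrC cfdot_mul_conj => il; exists i.
      by rewrite inE in Ii.
    by rewrite irr_consttE cfdotC_char ?irr_char.
  exists (T i); first by apply: imset_f; rewrite inE.
  rewrite inE irr_consttE mulrC cfdot_mul_conj.
  by rewrite cfdotC_char ?irr_char.
have tiT : trivIset (T @: I).
  apply/trivIsetP=> _ _ /imsetP[i Ii ->] /imsetP[j Ij ->].
  apply: contraR => /pred0Pn[k /andP[/= Tik Tjk]].
  by rewrite eqEsubset !(subT _ _ k).
(* The multiple is the number of distinct twists. *)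
exists #|T @: I|; rewrite -constt_weight_Ind_Res // /constt_weight -coverT.
rewrite sum_cfunE big_trivIset //= mulr_natl -sumr_const.
apply: eq_bigr => _ /imsetP[i Ii ->].
rewrite -sum_cfunE.
exact: constt_weight_lin chi _ (linI i Ii).
Qed.

End ConstituentDegrees.

(** * Functions constant on superclasses *)

Section SuperclassFunctions.

Local Open Scope group_scope.
Local Open Scope ring_scope.

Variables (gT : finGroupType) (G : {group gT}) (S : superdata G).
Hypothesis hS : supercharacter_theory S.

Let tiCl : trivIset (Cl S). Proof. by case: hS => _ /and3P[]. Qed.
Let coverCl : cover (Cl S) = G.
Proof. by case: hS => _ /and3P[/eqP]. Qed.
Let set0NCl : set0 \notin Cl S. Proof. by case: hS => _ /and3P[]. Qed.
Let tiX : trivIset (charParts S). Proof. by case: hS => /and3P[]. Qed.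
Let coverX : cover (charParts S) = [set: Iirr G].
Proof. by case: hS => /and3P[/eqP]. Qed.

Definition superclass_function (f : gT -> algC) :=
  forall K, K \in Cl S -> {in K &, forall x y, f x = f y}.

Lemma Cl_sub K : K \in Cl S -> K \subset G.
Proof. by rewrite -coverCl; apply: bigcup_sup. Qed.

Lemma supercl_in g : g \in G -> supercl S g \in Cl S.
Proof. by move=> Gg; apply: pblock_mem; rewrite coverCl. Qed.

Lemma mem_supercl g : g \in G -> g \in supercl S g.
Proof. by move=> Gg; rewrite mem_pblock coverCl. Qed.

Lemma Cl_repr K : K \in Cl S -> repr K \in K.
Proof.
move=> ClK; have [x Kx]: exists x, x \in K.
  by apply/set0Pn; apply: contraNneq set0NCl => <-.
exact: mem_repr Kx.
Qed.

Lemma charPart_of (i : Iirr G) :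
  exists2 X, X \in charParts S & i \in X.
Proof. by apply/bigcupP; rewrite -/(cover _) coverX. Qed.

Lemma charPart_eq X Y (i : Iirr G) :
  X \in charParts S -> Y \in charParts S -> i \in X -> i \in Y -> X = Y.
Proof.
by move=> SX SY iX iY; rewrite -(def_pblock tiX SX iX) (def_pblock tiX SY iY).
Qed.

Lemma charPart_neq0 X : X \in charParts S -> exists i, i \in X.
Proof.
case: hS => /and3P[_ _ X0] _ _ _ _ SX.
by apply/set0Pn; apply: contraNneq X0 => <-.
Qed.

(** The matrix of the values of the xi X on the S-classes has independent rows,
since the xi X have disjoint sets of constituents.  It is square because there
are as many parts of Irr(G) as S-classes, so its rows span. *)
Lemma superclass_function_basis : exists xi : {set Iirr G} -> 'CF(G),
  [/\ forall X, X \in charParts S -> {subset irr_constt (xi X) <= X},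
      forall X, X \in charParts S -> superclass_function (xi X)
    & forall f : gT -> algC, superclass_function f ->
      exists a : {set Iirr G} -> algC,
        {in G, forall x, f x = \sum_(X in charParts S) a X * xi X x}].
Proof.
case: (hS) => _ _ _ eqXK ex_xi.
have /fin_all_exists[xi xiP]: forall X, exists xi : 'CF(G),
    X \in charParts S -> [/\ xi \is a character, xi != 0,
     {subset irr_constt xi <= X} & superclass_function xi].
  move=> X; have [SX | _] := boolP (X \in charParts S); last by exists 0.
  by have [xi xiP] := ex_xi X SX; exists xi.
exists xi; split=> [X /xiP[] // | X /xiP[] // | f fS].
pose A := \matrix_(i < #|charParts S|, j < #|Cl S|)
  xi (enum_val i) (repr (enum_val j)).
have sum_enum (v : 'I_#|charParts S| -> algC) x :
    \sum_j v j * xi (enum_val j) x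
      = (\sum_j v j *: xi (enum_val j)) x.
  by rewrite sum_cfunE; apply: eq_bigr => j _; rewrite cfunE.
have eqS (g h : gT -> algC) : superclass_function g -> superclass_function h ->
    (forall j : 'I_#|Cl S|, g (repr (enum_val j)) = h (repr (enum_val j))) ->
    {in G, g =1 h}.
  move=> gS hS' gh x Gx; have ClK := supercl_in Gx.
  have Krepr := Cl_repr ClK; have Kx := mem_supercl Gx.
  rewrite (gS _ ClK x _ Kx Krepr) (hS' _ ClK x _ Kx Krepr).
  by have:= gh (enum_rank_in ClK (supercl S x)); rewrite enum_rankK_in.
have linS (v : 'I_#|charParts S| -> algC) :
    superclass_function (fun x => \sum_j v j * xi (enum_val j) x).
  move=> K ClK x y Kx Ky; apply: eq_bigr => j _; congr (_ * _).
  by have [_ _ _ /(_ K ClK x y Kx Ky)] := xiP _ (enum_valP j).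
have freeA: row_free A.
  apply: inj_row_free => v vA0; apply/rowP=> i; rewrite mxE.
  have v0: \sum_j v 0 j *: xi (enum_val j) = 0.
    apply/cfun_inP=> x Gx; rewrite -sum_enum cfunE.
    apply: (eqS _ (fun=> 0) (linS (v 0))) x Gx => // j.
    move/rowP/(_ j): vA0; rewrite !mxE => vAj0; rewrite -[RHS]vAj0.
    by apply: eq_bigr => k _; rewrite mxE.
  have [Nxi nz_xi sub_xi _] := xiP _ (enum_valP i).
  have [k xi_k] := neq0_has_constt nz_xi.
  have:= congr1 (fun phi => '[phi, 'chi_k]) v0.
  rewrite /= cfdot0l cfdot_suml (bigD1 i) //= big1 ?addr0 => [|j neq_ji].
    by move/eqP; rewrite cfdotZl mulf_eq0 (negPf xi_k) orbF => /eqP.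
  rewrite cfdotZl; have [_ _ sub_xj _] := xiP _ (enum_valP j).
  have [xj_k | ] := boolP (k \in irr_constt (xi (enum_val j))).
    case/eqP: neq_ji; apply: enum_val_inj.
    apply: charPart_eq (enum_valP j) (enum_valP i) _ (sub_xi k xi_k).
    exact: sub_xj.
  by rewrite inE negbK => /eqP->; rewrite mulr0.
have fullA: row_full A by rewrite /row_full (eqP freeA) eqXK.
have /submxP[v Dv] := submx_full (\row_j f (repr (enum_val j))) fullA.
have fE: {in G, forall x, f x = \sum_j v 0 j * xi (enum_val j) x}.
  apply: (eqS f _ fS (linS (v 0))) => j.
  move/rowP/(_ j): Dv; rewrite !mxE => ->.
  by apply: eq_bigr => k _; rewrite mxE.
have [X0 SX0 _] := charPart_of 0.
exists (fun X => v 0 (enum_rank_in SX0 X)) => x Gx.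
rewrite (fE x Gx) [RHS]big_enum_val; apply: eq_bigr => j _.
by rewrite enum_valK_in.
Qed.

(** The regular character is constant on S-classes because {1} is one of them.
Written in terms of the xi X, its components along the parts are on the one hand
multiples of the xi X, on the other hand the S-characters. *)
Lemma superchar_basis :
  (forall X, X \in charParts S -> superclass_function (superchar X))
  /\ (forall f : gT -> algC, superclass_function f ->
       exists b : {set Iirr G} -> algC,
       {in G, forall x, f x = \sum_(X in charParts S) b X * superchar X x}).
Proof.
have [xi [xi_sub xiS xi_span]] := superclass_function_basis.
have regS: superclass_function (cfReg G).
  move=> K ClK x y Kx Ky; rewrite !cfRegE.
  have K1 z t : z \in K -> t \in K -> z == 1%g -> t == 1%g.
    move=> Kz Kt /eqP z1; rewrite -in_set1; case: hS => _ _ Cl1 _ _.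
    have K1: 1%g \in K by rewrite -z1.
    by rewrite -(def_pblock tiCl Cl1 (set11 _)) (def_pblock tiCl ClK K1).
  by congr (_ *+ nat_of_bool _); apply/idP/idP; apply: K1.
have [a aP] := xi_span _ regS.
have sigmaE X : X \in charParts S -> superchar X = a X *: xi X.
  move=> SX; rewrite [RHS]cfun_sum_cfdot [LHS]cfun_sum_cfdot.
  apply: eq_bigr => i _; congr (_ *: _); rewrite cfdot_superchar cfdotZl.
  case: ifP => [Xi | X'i]; last first.
    have: i \notin irr_constt (xi X).
      by apply/negP=> /(xi_sub X SX); rewrite X'i.
    by rewrite inE negbK => /eqP->; rewrite mulr0.
  have ->: 'chi_i 1%g = '[cfReg G, 'chi_i].
    rewrite cfReg_sum cfdot_suml (bigD1 i) //= cfdotZl cfnorm_irr mulr1.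
    rewrite big1 ?addr0 // => j ne.
    by rewrite cfdotZl cfdot_irr (negPf ne) mulr0.
  have ->: cfReg G = \sum_(Y in charParts S) a Y *: xi Y.
    apply/cfun_inP=> x Gx; rewrite aP // sum_cfunE.
    by apply: eq_bigr => Y _; rewrite cfunE.
  rewrite cfdot_suml (bigD1 X) //= cfdotZl big1 ?addr0 // => Y /andP[SY neYX].
  rewrite cfdotZl; have [Yi | ] := boolP (i \in irr_constt (xi Y)).
    by case/eqP: neYX; apply: charPart_eq (xi_sub Y SY i Yi) Xi.
  by rewrite inE negbK => /eqP->; rewrite mulr0.
split=> [X SX K ClK x y Kx Ky | f fS].
  by rewrite sigmaE // !cfunE (xiS X SX K ClK x y).
have [b bP] := xi_span f fS; exists (fun X => b X / a X) => x Gx.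
rewrite bP //; apply: eq_bigr => X SX; rewrite sigmaE // cfunE mulrA divfK //.
have [i Xi] := charPart_neq0 SX; apply: contraTneq (irr1_neq0 i) => aX0.
move: (cfdot_superchar X i); rewrite sigmaE // aX0 scale0r cfdot0l Xi => <-.
by rewrite eqxx.
Qed.

Lemma superchar_superclass X :
  X \in charParts S -> superclass_function (superchar X).
Proof. exact: superchar_basis.1. Qed.

Lemma superclass_function_span f : superclass_function f ->
  exists b : {set Iirr G} -> algC,
    {in G, forall x, f x = \sum_(X in charParts S) b X * superchar X x}.
Proof. exact: superchar_basis.2. Qed.

(** * Unions of superclasses *)

(** Being a union of S-classes is stated pointwise, so that no family of
S-classes has to be exhibited. *)
Definition superclosed (A : {set gT}) :=
  A \subset G /\ {in A, forall x, supercl S x \subset A}.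

Lemma supercl_closed g : g \in G -> superclosed (supercl S g).
Proof.
move=> Gg; split=> [|x gx]; first exact: Cl_sub (supercl_in Gg).
by rewrite /supercl (def_pblock tiCl (supercl_in Gg) gx).
Qed.

Lemma superclosed_indicator A :
  superclosed A -> superclass_function (fun x => (x \in A)%:R).
Proof.
case=> _ clA K ClK x y Kx Ky.
have sub z t : z \in K -> t \in K -> z \in A -> t \in A.
  move=> Kz Kt /clA/subsetP; apply.
  by rewrite /supercl (def_pblock tiCl ClK Kz).
by congr (nat_of_bool _)%:R; apply/idP/idP; apply: sub.
Qed.

(** S-classes are unions of conjugacy classes: their indicators are combinations
of the S-characters, which are class functions. *)
Lemma superclosed_norm A : superclosed A -> G \subset 'N(A)%g.
Proof.
case=> sAG clA; apply/normsP=> z Gz; apply/eqP.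
rewrite eqEcard cardJg leqnn andbT; apply/subsetP=> _ /imsetP[x Ax ->].
have Gx: x \in G by apply: subsetP Ax.
apply: (subsetP (clA x Ax)).
have [b bP] :=
  superclass_function_span (superclosed_indicator (supercl_closed Gx)).
have: (x ^ z \in supercl S x)%g%:R == 1 :> algC.
  rewrite bP ?groupJ // (eq_bigr (fun X => b X * superchar X x)) => [|X _].
    by rewrite -bP // mem_supercl.
  by rewrite cfunJ.
by case: (_ \in _) => //; rewrite eq_sym oner_eq0.
Qed.

(** Up to a scalar, the S-characters are orthogonal idempotents for convolution,
since distinct irreducible characters have convolution zero and the factor
psi(1) compensates the denominator in psi * psi = |G| psi / psi(1). *)
Lemma superchar_convolution X Y y : X \in charParts S -> Y \in charParts S ->
  \sum_(x in G) superchar X (x * y)%g * superchar Y x^-1%g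
    = (X == Y)%:R * (#|G|%:R * superchar X y).
Proof.
move=> SX SY; have nzG := neq0CG G.
transitivity (\sum_(i in X) \sum_(j in Y) 'chi_i 1%g * 'chi_j 1%g *
    (#|G|%:R * ((i == j)%:R * ('chi_i y / 'chi_i 1%g)))).
  under [RHS]eq_bigr => i _ do under eq_bigr => j _ do
    rewrite -generalized_orthogonality_relation mulVKf // mulr_sumr.
  under [RHS]eq_bigr => i _ do rewrite exchange_big /=.
  rewrite exchange_big /=; apply: eq_bigr => x _.
  rewrite !sum_cfunE mulr_suml; apply: eq_bigr => i _.
  rewrite mulr_sumr; apply: eq_bigr => j _.
  by rewrite !cfunE mulrACA.
have [eqXY | neqXY] := eqVneq X Y; last first.
  rewrite mul0r big1 // => i Xi; rewrite big1 // => j Yj.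
  case: eqP => [eq_ij | _]; last by rewrite mul0r !mulr0.
  by case/eqP: neqXY; apply: charPart_eq SX SY Xi _; rewrite eq_ij.
rewrite -eqXY mul1r sum_cfunE mulr_sumr; apply: eq_bigr => i Xi.
rewrite (bigD1 i) //= big1 ?addr0 => [|j /andP[_ ne_ji]]; last first.
  by rewrite eq_sym (negPf ne_ji) mul0r !mulr0.
have nzi := irr1_neq0 i.
by rewrite eqxx mul1r cfunE mulrCA -mulrA [_ * (_ / _)]mulrC divfK.
Qed.

(** The convolution F of the indicators of A and B counts the factorizations
t = uv with u in A and v in B, so that its support is AB.  It is constant on
S-classes, by the expansion of the indicators on the S-characters. *)
Lemma superclosedM A B :
  superclosed A -> superclosed B -> superclosed (A * B)%g.
Proof.
move=> clA clB; have [[sAG _] [sBG _]] := (clA, clB).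
split=> [|y ABy]; first exact: mul_subG.
have [a aP] := superclass_function_span (superclosed_indicator clA).
have [b bP] := superclass_function_span (superclosed_indicator clB).
(* The substitution u = x^-1, v = x y gives the form of convolution that occurs
   in the orthogonality relations. *)
pose F y : algC := \sum_(x in G) (x * y \in B)%g%:R * (x^-1 \in A)%g%:R.
have FE : {in G, forall t, F t =
    \sum_(X in charParts S) b X * a X * (#|G|%:R * superchar X t)}.
  move=> t Gt; rewrite /F; under eq_bigr => x Gx do
    rewrite aP ?groupV // bP ?groupM // mulr_suml.
  rewrite exchange_big; apply: eq_bigr => X SX /=.
  under eq_bigr => x _ do rewrite mulr_sumr.
  rewrite exchange_big /=.
  rewrite (bigD1 X) //= [X in _ + X]big1 ?addr0 => [|Y /andP[SY neYX]].
    under eq_bigr => x _ do rewrite mulrACA.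
    by rewrite -mulr_sumr superchar_convolution // eqxx mul1r.
  under eq_bigr => x _ do rewrite mulrACA.
  rewrite -mulr_sumr superchar_convolution // eq_sym (negPf neYX).
  by rewrite mul0r mulr0.
have F_neq0 t : t \in G -> (F t != 0) = (t \in A * B)%g.
  move=> Gt; have F_ge0 x : x \in G ->
    (0 : algC) <= (x * t \in B)%g%:R * (x^-1 \in A)%g%:R.
    by rewrite -natrM ler0n.
  apply/idP/mulsgP=> [nzF | [u v Au Bv def_t]].
    have /existsP[x /andP[Gx]]:
        [exists x in G, (x * t \in B)%g && (x^-1 \in A)%g].
      apply: contraR nzF => /existsPn Fx0; rewrite /F big1 // => x Gx.
      by have:= Fx0 x; rewrite Gx /= -natrM mulnb => /negPf->.
    by case/andP=> Bxt Axi; exists x^-1%g (x * t)%g; rewrite ?mulKg.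
  have Gu: u \in G by apply: subsetP Au.
  rewrite /F psumr_eq0 //; apply/negP=> /allP/(_ u^-1%g).
  rewrite mem_index_enum groupV Gu def_t mulKg Bv invgK Au mulr1 oner_eq0.
  by move/(_ isT).
have Gy: y \in G by apply: subsetP ABy; apply: mul_subG.
apply/subsetP=> z yz; have ClK := supercl_in Gy.
have Gz: z \in G by apply: subsetP (Cl_sub ClK) _ yz.
rewrite -F_neq0 // -(_ : F y = F z) ?F_neq0 // !FE //.
apply: eq_bigr => X SX; do 2!congr (_ * _).
exact: (superchar_superclass SX ClK) (mem_supercl Gy) yz.
Qed.

Lemma superNormal_closed (N : {group gT}) : superNormal S N -> superclosed N.
Proof.
case/existsP=> A /andP[/subsetP sA /eqP ->]; split=> [|x /bigcupP[K AK Kx]].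
  by apply/bigcupsP=> K /sA; apply: Cl_sub.
by rewrite /supercl (def_pblock tiCl (sA K AK) Kx); apply: bigcup_sup.
Qed.

Lemma cfker_superclosed X :
  X \in charParts S -> superclosed (cfker (superchar X)).
Proof.
move=> SX; split=> [|x]; first exact: cfker_sub.
rewrite (cfkerEchar (superchar_char X)) => /setIdP[Gx /eqP chi_x].
have ClK := supercl_in Gx; apply/subsetP=> y xy; rewrite inE.
rewrite (subsetP (Cl_sub ClK)) // -chi_x.
by rewrite (superchar_superclass SX ClK xy (mem_supercl Gx)) eqxx.
Qed.

(** * Central sections and the sizes of superclasses *)

Definition supercentral_mod (M N : {group gT}) :=
  {in M, forall m, supercl S m \subset (m *: N)%g}.

(** The block of the coset mN is the image K / N of some S-class K, which need
not be the class of m.  It has a single element, so KN = mN; as KN is a union of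
S-classes containing m, it contains cl(m). *)
Lemma superCenter_quo (M N : {group gT}) :
    superclosed N -> M \subset G ->
    (M / N)%g \subset superCenter (superQuo S N) -> supercentral_mod M N.
Proof.
move=> clN sMG sMZ m Mm; have Gm := subsetP sMG m Mm.
have nNG := superclosed_norm clN.
have := subsetP sMZ _ (mem_quotient N Mm); rewrite inE => /andP[_].
rewrite /supercl /=; set P := [set _ | _ in _] => card1.
have mem_quo (A : {set gT}) x : x \in G -> x \in A -> coset N x \in (A / N)%g.
  by move=> Gx Ax; apply: mem_morphim Ax; apply: subsetP Gx.
have Pm: coset N m \in cover P.
  apply/bigcupP; exists (supercl S m / N)%g; first exact/imset_f/supercl_in.
  by apply: mem_quo; rewrite ?mem_supercl.
have /imsetP[K ClK defK] := pblock_mem Pm.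
have mK : coset N m \in (K / N)%g by rewrite -defK mem_pblock.
have sKG := Cl_sub ClK.
have [_ clKN] : superclosed (K * N)%g.
  apply: superclosedM clN; split=> // x Kx.
  by rewrite /supercl (def_pblock tiCl ClK Kx).
have coset_in k x :
    k \in G -> coset N x = coset N k -> x \in G -> x \in (k *: N)%g.
  move=> Gk eq_xk Gx; rewrite -norm_rlcoset ?(subsetP nNG) //.
  by apply/rcoset_kercosetP; rewrite ?(subsetP nNG).
have /morphimP[k _ Kk eq_mk] := mK; have Gk := subsetP sKG k Kk.
have KNm: m \in (K * N)%g.
  have /lcosetP[n Nn ->] := coset_in k m Gk eq_mk Gm.
  exact: mem_mulg.
apply: subset_trans (clKN m KNm) _.
have sKm: K \subset (m *: N)%g.
  have /cards1P[c defc] : #|(K / N)%g| == 1%N by rewrite -defK.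
  apply/subsetP=> x Kx; have Gx := subsetP sKG x Kx; apply: coset_in => //.
  have:= mem_quo K x Gx Kx; rewrite defc inE => /eqP->.
  by move: mK; rewrite defc inE => /eqP->.
by apply: subset_trans (mulSg N sKm) _; rewrite -mulgA mulGid.
Qed.

(** The translates KNm of KN partition KM: each is a union of S-classes, as
cl(m)N = mN, so that two translates that meet coincide. *)
Lemma dvdn_card_superclass_mul g (M N : {group gT}) :
    g \in G -> M \subset G -> superclosed N -> N \subset M ->
    supercentral_mod M N ->
  (#|(supercl S g * N)%g| %| #|(supercl S g * M)%g|)%N.
Proof.
move=> Gg sMG clN sNM ZMN; set K := supercl S g.
have clK: superclosed K by apply: supercl_closed.
have nNM : M \subset 'N(N)%g := subset_trans sMG (superclosed_norm clN).
pose R m := (K * (N :* m))%g.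
have RM m1 m2 : m1 \in M -> m2 \in M -> (R m1 * (N :* m2) = R (m1 * m2))%g.
  by move=> Mm1 Mm2; rewrite /R -mulgA rcoset_mul ?(subsetP nNM).
have clR m : m \in M -> superclosed (R m).
  move=> Mm; have Gm := subsetP sMG m Mm.
  suff ->: R m = (K * (supercl S m * N))%g.
    by do 2!apply: superclosedM => //; apply: supercl_closed.
  congr (_ * _)%g; apply/eqP; rewrite norm_rlcoset ?(subsetP nNM) //.
  rewrite eqEsubset mulSg ?sub1set ?mem_supercl //=.
  by apply: subset_trans (mulSg N (ZMN m Mm)) _; rewrite -mulgA mulGid.
have meetR m1 m2 x : m1 \in M -> m2 \in M -> x \in R m1 -> x \in R m2 ->
    R m1 \subset R m2.
  move=> Mm1 Mm2 /mulsgP[k y Kk Ny def_x] R2x.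
  have Mm21 : (m2 * m1^-1)%g \in M by rewrite groupM ?groupV.
  (* This translate of R m2 is superclosed and meets K, hence contains it. *)
  have Rk: k \in R (m2 * m1^-1)%g.
    rewrite -RM ?groupV // -[k](mulgK y) -def_x mem_mulg //.
    by rewrite norm_rlcoset ?groupV ?(subsetP nNM) // -invg_rcoset memV_invg.
  have sKR: K \subset R (m2 * m1^-1)%g.
    have [_ /(_ k Rk)] := clR _ Mm21.
    by rewrite /supercl (def_pblock tiCl (supercl_in Gg) Kk).
  apply: subset_trans (mulSg _ sKR) _.
  by rewrite RM // mulgKV.
pose P := [set R m | m in M].
have partP : partition P (K * M)%g.
  apply/and3P; split.
  - rewrite eqEsubset; apply/andP; split; apply/subsetP=> x.
      case/bigcupP=> _ /imsetP[m Mm ->]; apply/subsetP.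
      by rewrite mulgS // mul_subG ?sub1set.
    case/mulsgP=> k m Kk Mm ->; apply/bigcupP.
    exists (R m); first exact: imset_f.
    by rewrite mem_mulg ?rcoset_refl.
  - apply/trivIsetP=> _ _ /imsetP[m1 Mm1 ->] /imsetP[m2 Mm2 ->].
    apply: contraR => /pred0Pn[x /andP[/= R1x R2x]].
    by rewrite eqEsubset !(meetR _ _ x).
  apply/imsetP=> -[m Mm R0]; have: (g * m)%g \in R m.
    by rewrite mem_mulg ?rcoset_refl ?mem_supercl.
  by rewrite -R0 inE.
rewrite (@card_uniform_partition _ #|(K * N)%g| P _ _ partP) ?dvdn_mull //.
by move=> _ /imsetP[m Mm ->]; rewrite /R mulgA card_rcoset.
Qed.

Theorem dvdn_card_superclass r N g :
  superCentralSeries S r N -> g \in G -> (#|supercl S g| %| #|G|)%N.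
Proof.
case=> N0 Nr nN cN Gg; have sNG i : (i <= r)%N -> N i \subset G.
  by move/nN/superNormal_closed=> [].
have dvdN i : (i <= r)%N -> (#|(supercl S g * N i)%g| %| #|G|)%N.
  elim: i => [|i IHi] le_ir.
    by rewrite N0 (mulSgGid (mem_supercl Gg)) ?(Cl_sub (supercl_in Gg)).
  apply: dvdn_trans (IHi (ltnW le_ir)).
  have [sN cNi] := cN i le_ir; have clN := superNormal_closed (nN _ le_ir).
  apply: dvdn_card_superclass_mul; rewrite ?sNG ?(ltnW le_ir) //.
  by apply: superCenter_quo; rewrite ?sNG ?(ltnW le_ir).
by have:= dvdN r (leqnn r); rewrite Nr mulg1.
Qed.

(** * Central sections and the degrees of supercharacters *)

(** On the part X, the multiplicities in phi are proportional to the degrees,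
since phi is a combination of S-characters. *)
Lemma constt_superclass_function (phi : 'CF(G)) X i j :
    superclass_function phi -> X \in charParts S -> i \in X -> j \in X ->
  i \in irr_constt phi -> j \in irr_constt phi.
Proof.
move=> phiS SX Xi Xj; have [b bP] := superclass_function_span phiS.
have phi_dot k : k \in X -> '[phi, 'chi_k] = b X * 'chi_k 1%g.
  move=> Xk; have ->: phi = \sum_(Y in charParts S) b Y *: superchar Y.
    apply/cfun_inP=> x Gx; rewrite bP // sum_cfunE.
    by apply: eq_bigr => Y _; rewrite cfunE.
  rewrite cfdot_suml (bigD1 X) //= cfdotZl cfdot_superchar Xk big1 ?addr0 //.
  move=> Y /andP[SY neYX]; rewrite cfdotZl cfdot_superchar.
  case: ifP => [Yk | _]; last by rewrite mulr0.
  by case/eqP: neYX; apply: charPart_eq SY SX Yk Xk.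
by rewrite !irr_consttE !phi_dot // !mulf_eq0 !negb_or !irr1_neq0.
Qed.

Lemma mem_superclJ x z : x \in G -> z \in G -> (x ^ z)%g \in supercl S x.
Proof.
move=> Gx Gz; have /subsetP/(_ z Gz) nz := superclosed_norm (supercl_closed Gx).
by rewrite memJ_norm ?mem_supercl.
Qed.

Section CentralSection.

Variables M N : {group gT}.
Hypotheses (clM : superclosed M) (ZMN : supercentral_mod M N).

Let sMG : M \subset G. Proof. by case: clM. Qed.
Let nsMG : (M <| G)%g.
Proof. by rewrite /normal sMG superclosed_norm. Qed.

(** x^y lies in cl(x), hence in xN. *)
Lemma supercentral_der1 : (M^`(1) \subset N)%g.
Proof.
rewrite derg1 gen_subG; apply/subsetP=> _ /imset2P[x y Mx My ->].
rewrite commgEl -mem_lcoset; apply: subsetP (ZMN Mx) _ _.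
by apply: mem_superclJ; apply: (subsetP sMG).
Qed.

Variables (lambda : 'CF(M)).
Hypotheses (kerN : N \subset cfker lambda).

Lemma supercentral_cfun_const x y :
  x \in M -> y \in supercl S x -> lambda y = lambda x.
Proof.
move=> Mx xy; have /lcosetP[n Nn ->] := subsetP (ZMN Mx) y xy.
by rewrite cfkerMr ?(subsetP kerN).
Qed.

(** lambda is invariant in G, since x^z lies in cl(x), on which lambda is
constant. *)
Lemma cfRes_Ind_supercentral : 'Res[M] ('Ind[G] lambda) = #|G : M|%:R *: lambda.
Proof.
apply/cfun_inP=> x Mx; have Gx := subsetP sMG x Mx.
rewrite cfResE // cfIndE // cfunE (eq_bigr (fun=> lambda x)) => [|z Gz].
  rewrite sumr_const -[lambda x *+ _]mulr_natl mulrA natf_indexg //.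
  by rewrite [_^-1 * _]mulrC.
by apply: supercentral_cfun_const; rewrite ?mem_superclJ.
Qed.

Lemma superclass_function_Ind : superclass_function ('Ind[G] lambda).
Proof.
move=> K ClK x y Kx Ky; have := superclosed_indicator clM ClK Kx Ky.
have Gx := subsetP (Cl_sub ClK) x Kx.
have [Mx | M'x] := boolP (x \in M); have [My | M'y] := boolP (y \in M) => /eqP.
- rewrite -!(cfResE ('Ind[G] lambda) sMG) // cfRes_Ind_supercentral !cfunE => _.
  by rewrite (supercentral_cfun_const Mx) // /supercl (def_pblock tiCl ClK Kx).
- by rewrite oner_eq0.
- by rewrite eq_sym oner_eq0.
by rewrite !(cfun_on0 (cfInd_normal lambda nsMG)).
Qed.

End CentralSection.

(** If Res sigma_X and its twist by lambda share a constituent, then by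
Frobenius reciprocity Ind(lambda) sigma_X shares one with sigma_X.  It is
constant on S-classes, so it contains all of X; restricting back to M, where
Ind(lambda) is a multiple of lambda, all constituents of Res sigma_X occur in
the twist. *)
Lemma constt_weight_supercentral X (M N : {group gT}) :
    X \in charParts S -> superclosed M -> superclosed N -> N \subset M ->
    supercentral_mod M N ->
  exists m : nat, #|M : N|%g%:R * constt_weight ('Res[N] (superchar X))
    = m%:R * constt_weight ('Res[M] (superchar X)).
Proof.
move=> SX clM clN sNM ZMN; have [sMG _] := clM.
have nsNM : (N <| M)%g.
  by rewrite /normal sNM (subset_trans sMG) ?superclosed_norm.
have Nsig := superchar_char X.
rewrite -(cfResRes _ sNM sMG).
apply: constt_weight_Res_multiple => //; first exact: supercentral_der1.
  exact: cfRes_char.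
move=> lambda Llam kerN; have Nlam := lin_charW Llam.
have Nind : 'Ind[G] lambda * superchar X \is a character.
  by rewrite rpredM ?cfInd_char.
rewrite mulrC cfdot_Res_l cfIndM // => /(cfdot_char_neq0P Nsig Nind)[i].
rewrite constt_superchar => Xi phi_i j res_j.
have /(constt_ResS Nsig Nind)/(_ j res_j) :
    {subset irr_constt (superchar X)
       <= irr_constt ('Ind[G] lambda * superchar X)}.
  move=> k; rewrite constt_superchar => Xk.
  apply: (constt_superclass_function _ SX Xi Xk phi_i) => K ClK x y Kx Ky.
  rewrite !cfunE (superchar_superclass SX ClK Kx Ky) //.
  by rewrite (superclass_function_Ind clM ZMN kerN ClK Kx Ky).
rewrite rmorphM /= (cfRes_Ind_supercentral clM ZMN kerN) -scalerAl !irr_consttE.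
by rewrite cfdotZl mulf_eq0 => /norP[].
Qed.

Lemma superclosed_joing (M L : {group gT}) :
  superclosed M -> superclosed L -> superclosed (M <*> L)%g.
Proof.
move=> clM clL; have [sMG _] := clM.
rewrite norm_joinEl ?(subset_trans sMG) ?superclosed_norm //.
exact: superclosedM.
Qed.

(** For l in L, cl(ml) lies in cl(m) L, a union of S-classes, and so in mNL. *)
Lemma supercentral_joing (M N L : {group gT}) :
    superclosed M -> superclosed N -> superclosed L -> supercentral_mod M N ->
  supercentral_mod (M <*> L)%G (N <*> L)%G.
Proof.
move=> clM clN clL ZMN x /=; have [[sMG _] [sNG _]] := (clM, clN).
have [sLG _] := clL; have nLG := superclosed_norm clL.
rewrite norm_joinEl ?(subset_trans sMG) // => /mulsgP[m l Mm Ll ->].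
have Gm := subsetP sMG m Mm; have Gl := subsetP sLG l Ll.
have [_ clml] := superclosedM (supercl_closed Gm) clL.
apply: subset_trans (clml (m * l)%g _) _.
  by rewrite mem_mulg ?mem_supercl.
apply: subset_trans (mulSg L (ZMN m Mm)) _.
rewrite lcosetM (lcoset_id (subsetP (joing_subr N L) l Ll)).
by rewrite /= norm_joinEl ?(subset_trans sNG) // -mulgA.
Qed.

(** The central series is multiplied by the kernel of the S-character, so that it
ends where the restriction is a multiple of the principal character. *)
Theorem dvdC_superchar1 r N X :
    superCentralSeries S r N -> X \in charParts S ->
  (superchar X 1%g %| #|G : cfker (superchar X)|%g)%C.
Proof.
case=> N0 Nr nN cN SX; pose sigma := superchar X.
pose L := [group of cfker sigma].
have clL : superclosed L by apply: cfker_superclosed.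
have clN i : (i <= r)%N -> superclosed (N i) by move/nN/superNormal_closed.
pose M i := (N i <*> L)%G.
have clM i : (i <= r)%N -> superclosed (M i).
  by move=> le_ir; apply: superclosed_joing (clN i le_ir) clL.
have M0 : M 0%N = G.
  by apply: val_inj; rewrite /= N0; apply/joing_idPl; apply: cfker_sub.
have Mr : M r = L by apply: val_inj; rewrite /= Nr; apply: joing1G.
pose w i := constt_weight ('Res[M i] sigma).
have wE i : (i <= r)%N -> exists m : nat, #|G : M i|%g%:R * w i = m%:R * w 0%N.
  elim: i => [|i IHi] le_ir; first by exists 1%N; rewrite M0 indexgg.
  have [m Em] := IHi (ltnW le_ir); have [sN cNi] := cN i le_ir.
  have sM : M i.+1 \subset M i by rewrite /= genS ?setSU.
  have [clNi clNi1] := (clN i (ltnW le_ir), clN _ le_ir).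
  have ZN : supercentral_mod (N i) (N i.+1).
    by apply: superCenter_quo => //; case: clNi.
  have ZM := supercentral_joing clNi clNi1 clL ZN.
  have [clMi clMi1] := (clM i (ltnW le_ir), clM _ le_ir).
  have [n En] := constt_weight_supercentral SX clMi clMi1 sM ZM.
  exists (n * m)%N; have [sMG _] := clMi.
  rewrite -(Lagrange_index sMG sM) natrM -mulrA En mulrCA Em.
  by rewrite natrM mulrA.
have w0 : w 0%N = sigma 1%g.
  rewrite /w M0 cfRes_id /constt_weight; congr (superchar _ _); apply/setP=> i.
  by rewrite inE constt_superchar.
have wr : w r = 1.
  have resL : 'Res[L] sigma = sigma 1%g *: 'chi_0.
    apply/cfun_inP=> x Lx; rewrite cfResE ?cfker_sub // cfker1 // irr0 cfunE.
    by rewrite cfun1E Lx mulr1.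
  have nz_sigma1 : sigma 1%g != 0.
    rewrite char1_eq0 ?superchar_char //; have [i Xi] := charPart_neq0 SX.
    apply: contraTneq (irr1_neq0 i) => sigma0.
    have:= cfdot_superchar X i; rewrite -/sigma sigma0 cfdot0l Xi => <-.
    by rewrite eqxx.
  rewrite /w Mr /constt_weight (_ : constts _ = [set 0]).
    by rewrite /superchar big_set1 irr0 cfunE !cfun1E group1 mulr1.
  apply/setP=> i; rewrite !inE resL cfdotZl cfdot_irr mulf_eq0 negb_or.
  by rewrite nz_sigma1 pnatr_eq0 eqb0 negbK eq_sym.
have [m Em] := wE r (leqnn r).
apply/dvdCP; exists m%:R => //.
by rewrite -w0 -Em wr mulr1 Mr.
Qed.

End SuperclassFunctions.

Theorem theorem2 (gT : finGroupType) (G : {group gT}) (S : superdata G)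
    (hS : supercharacter_theory S) (hnil : superNilpotent S) :
  (forall chi : 'CF(G), chi \in Ch S ->
     (chi 1%g %| #|G : cfker chi|%g)%C)
  /\ (forall g : gT, g \in G -> #|supercl S g| %| #|G|).
Proof.
have [r [N serN]] := hnil; split=> [chi /imageP[X SX ->] | g Gg].
  exact (dvdC_superchar1 hS serN SX).
exact (dvdn_card_superclass hS serN Gg).
Qed.
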